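(* Let $\mathcal{L}:\mathbb{R}^m\to\mathbb{R}^m$ be of class $C^4$, put $\mathcal{G}(u):=\mathcal{L}_u(u)\mathcal{L}(u)$, where $\mathcal{L}_u$ is the Jacobian of $\mathcal{L}$, and let $u$ be a solution of $u'(t)=\mathcal{L}(u(t))$ on an open interval containing $t_n$. Let $C,D\in\mathbb{R}$ be arbitrary. Then, as $\Delta t\to 0^+$, writing $u_0=u(t_n)$, $u_{1/2}=u(t_n+\tfrac12\Delta t)$, $u_1=u(t_n+\Delta t)$, both stages of the implicit two-stage scheme with parameters $C,D$ are satisfied by the exact solution up to $O(\Delta t^5)$: $$u_{1/2}=u_0+\frac{\Delta t}{4}\left[\mathcal{L}(u_0)+\mathcal{L}(u_{1/2})\right]+\frac{\Delta t^2}{48}\left[\mathcal{G}(u_0)-\mathcal{G}(u_{1/2})\right]+O(\Delta t^5),$$ $$\begin{aligned}u_1=u_0&+\Delta t\left[\left(\tfrac16+4C+\tfrac12D\right)\mathcal{L}(u_0)+\left(\tfrac23-8C+2D\right)\mathcal{L}(u_{1/2})+\left(\tfrac16+4C-\tfrac52D\right)\mathcal{L}(u_1)\right]\\&+\Delta t^2\left[C\,\mathcal{G}(u_0)+D\,\mathcal{G}(u_{1/2})+\left(\tfrac12D-C\right)\mathcal{G}(u_1)\right]+O(\Delta t^5).\end{aligned}$$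
   Context: The implicit two-stage fourth-order scheme for $u'=\mathcal{L}(u)$ is obtained from the two displayed relations by dropping the $O(\Delta t^5)$ terms and replacing $u_0,u_{1/2},u_1$ by the numerical approximations $u^n,u^{n+1/2},u^{n+1}$. The quantity $\mathcal{G}(u)=\mathcal{L}_u(u)\mathcal{L}(u)$ is the time derivative $\frac{\partial}{\partial t}\mathcal{L}(u(t))$ along solutions. ''Fourth-order'' means that the exact solution satisfies both stages with residual $O(\Delta t^5)$. *)

(* Defs.v *)
From mathcomp Require Import all_boot all_order all_algebra.
From mathcomp Require Import all_classical all_reals all_analysis.

Set Implicit Arguments.
Unset Strict Implicit.
Unset Printing Implicit Defensive.

Import Order.TTheory GRing.Theory Num.Theory.
Import numFieldNormedType.Exports.

Local Open Scope classical_set_scope.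
Local Open Scope ring_scope.

(* f is of class C^k on R^m.  In finite dimension the derivative Df is of class
   C^k as a map into the space of linear maps iff x |-> Df(x) v is of class C^k
   for every vector v, which avoids putting a norm on that space. *)
Fixpoint class_C (R : realType) (m p k : nat) (f : 'rV[R]_m -> 'rV[R]_p) : Prop :=
  if k is k'.+1 then
    (forall x, differentiable f x) /\
    (forall v, class_C k' (fun x => 'd f x v))
  else continuous f.

(* G(u) = L_u(u) L(u).  Elements of R^m are row vectors, on which the Jacobian
   matrix 'J acts on the right: v *m 'J L x = 'd L x v. *)
Definition calG (R : realType) (m : nat) (L : 'rV[R]_m -> 'rV[R]_m)
    (x : 'rV[R]_m) : 'rV[R]_m :=
  L x *m 'J L x.

(* u need only be meaningful on I, the values of u outside I are irrelevant. *)
Definition solves_on (R : realType) (m : nat) (L : 'rV[R]_m -> 'rV[R]_m)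
    (u : R -> 'rV[R]_m) (I : set R) : Prop :=
  forall t, I t -> is_derive t 1 u (L (u t)).

(* Main.v *)
Require Import Defs.
From HB Require Import structures.
From mathcomp Require Import all_boot all_order all_algebra.
From mathcomp Require Import all_classical all_reals all_analysis.
From mathcomp Require Import ring lra.

Set Implicit Arguments.
Unset Strict Implicit.
Unset Printing Implicit Defensive.

Import Order.TTheory GRing.Theory Num.Theory.
Import numFieldNormedType.Exports.

Local Open Scope classical_set_scope.
Local Open Scope ring_scope.

(** Along a solution, d/dt f(u) = (df . L)(u), so the k-th derivative of u is
    the (k-1)-st iterate of f |-> df . L, started at L and evaluated on u; as L
    is C^4, u has a continuous, hence locally bounded, fifth derivative.  Taylor
    expansion of u, u' = L(u) and u'' = G(u) at tn, to orders 5, 4 and 3, turns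
    each residual into a polynomial of degree at most 4 in dt plus remainders of
    size O(dt^5), and the coefficients of both stages make that polynomial
    vanish. *)

(** * Differentials of a scalar multiple and of a matrix coordinate *)

Lemma scaler_bilinear (R : numFieldType) (V : normedModType R) :
  bilinear_for
    (GRing.Scale.Law.clone _ _ *:%R _) (GRing.Scale.Law.clone _ _ *:%R _)
    (@GRing.scale R V : R^o -> V -> V).
Proof.
by split=> [v|k] a x y /=; rewrite ?scalerDl ?scalerDr ?scalerA // mulrC.
Qed.

(** Scaling is a continuous bilinear map on pairs, so the product rule is the chain rule applied to
    [y |-> (k y, f y)] followed by scaling. *)
Lemma is_diff_scale (R : numFieldType) (U V : normedModType R)
    (k dk : U -> R^o) (f df : U -> V) (x : U) :
  is_diff x k dk -> is_diff x f df ->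
  is_diff x (fun y => (k y : R) *: f y) (fun v => k x *: df v + dk v *: f x).
Proof.
move=> kx fx.
pose scM := bilinear_isBilinear.Build R R^o V V _ _
  (@GRing.scale R V : R^o -> V -> V) (@scaler_bilinear R V).
pose sc : {bilinear R^o -> V -> V} := HB.pack (@GRing.scale R V : R^o -> V -> V) scM.
have sc_cont : continuous (fun p : R^o * V => sc p.1 p.2).
  exact: scale_continuous.
have sc_diff : is_diff (k x, f x) (fun p : R^o * V => sc p.1 p.2)
    (fun q => sc (k x) q.2 + sc q.1 (f x)).
  by apply: DiffDef; [exact: differentiable_bilin|rewrite diff_bilin].
exact: (is_diff_comp (is_diff_pair kx fx) sc_diff).
Qed.

Lemma is_diff_coord (R : numFieldType) (m n : nat) (M : 'M[R]_(m, n)) i j :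
  is_diff M (fun N => N i j : R^o) (fun N => N i j : R^o).
Proof.
have @f : {linear 'M[R]_(m, n) -> R^o}.
  by exists (fun N : 'M[R]_(_, _) => N i j); do 2![eexists]; do ?[constructor];
     rewrite ?mxE// => ? *; rewrite ?mxE//; move=> ?; rewrite !mxE.
have fc : continuous f by exact: coord_continuous.
have -> : (fun N : 'M[R]_(m, n) => N i j : R^o) = f by [].
by apply: DiffDef; [exact: linear_differentiable|rewrite diff_lin].
Qed.

(** * Closure properties of the maps of class C^k *)

Section ClassC.
Variables (R : realType) (m : nat).

Lemma class_C_continuous (p k : nat) (f : 'rV[R]_m -> 'rV[R]_p) :
  class_C k f -> continuous f.
Proof.
by case: k => [//|k] [df _] x; exact/differentiable_continuous/df.
Qed.

Lemma class_C_leS (p k : nat) (f : 'rV[R]_m -> 'rV[R]_p) :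
  class_C k.+1 f -> class_C k f.
Proof.
elim: k f => [|k IH] f fC; first exact: class_C_continuous fC.
by case: fC => df dfC; split=> // v; exact/IH/dfC.
Qed.

Lemma class_C_le (p j k : nat) (f : 'rV[R]_m -> 'rV[R]_p) :
  (j <= k)%N -> class_C k f -> class_C j f.
Proof.
move=> /subnK <-; elim: (k - j)%N => // i IH fC.
by apply: IH; exact: class_C_leS.
Qed.

(** Lets inductions on [k] work with an explicit formula [df] for the differential instead of
    ['d f]. *)
Lemma is_diff_class_CS (p k : nat) (f : 'rV[R]_m -> 'rV[R]_p)
    (df : 'rV[R]_m -> 'rV[R]_m -> 'rV[R]_p) :
  (forall x, is_diff x f (df x)) -> (forall v, class_C k (fun x => df x v)) ->
  class_C k.+1 f.
Proof.
move=> fdf dfC; split=> [x|v]; first exact: ex_diff.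
rewrite (_ : (fun _ => _) = fun x => df x v) //.
by apply/funext => x; rewrite (@diff_val _ _ _ _ _ _ _ (fdf x)).
Qed.

Lemma class_C_cst (p k : nat) (c : 'rV[R]_p) :
  class_C k (fun _ : 'rV[R]_m => c).
Proof.
elim: k c => [|k IH] c; first by move=> x; apply: cst_continuous.
apply: (@is_diff_class_CS _ _ _ (fun _ _ => 0)) => v; exact: IH.
Qed.

Lemma class_CD (p k : nat) (f g : 'rV[R]_m -> 'rV[R]_p) :
  class_C k f -> class_C k g -> class_C k (fun x => f x + g x).
Proof.
elim: k f g => [|k IH] f g; first by move=> fc gc x; exact: cvgD (fc x) (gc x).
move=> [df dfC] [dg dgC].
apply: (@is_diff_class_CS _ _ _ (fun x v => 'd f x v + 'd g x v)) => [x|v].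
  exact: is_diffD (differentiableP (df x)) (differentiableP (dg x)).
exact: (IH _ _ (dfC v) (dgC v)).
Qed.

Lemma class_C_sum (p k n : nat) (f : 'I_n -> 'rV[R]_m -> 'rV[R]_p) :
  (forall i, class_C k (f i)) -> class_C k (fun x => \sum_(i < n) f i x).
Proof.
elim: n f => [|n IH] f fC.
  rewrite (_ : (fun _ => _) = (fun _ => 0)); first exact: class_C_cst.
  by apply/funext => x; rewrite big_ord0.
rewrite (_ : (fun _ => _) =
    fun x => \sum_(i < n) f (widen_ord (leqnSn n) i) x + f ord_max x).
  by apply: class_CD => //; apply: IH.
by apply/funext => x; rewrite big_ord_recr.
Qed.

(** [class_C] only speaks of maps into row vectors, so the scalar factor enters as a coordinate of
    such a map. In each Leibniz term one factor is differentiated; the other is weakened from order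
    k+1 to k so that the induction hypothesis applies. *)
Lemma class_C_scale (q p k : nat) (g : 'rV[R]_m -> 'rV[R]_q)
    (h : 'rV[R]_m -> 'rV[R]_p) (j : 'I_q) :
  class_C k g -> class_C k h -> class_C k (fun x => g x 0 j *: h x).
Proof.
elim: k g h => [|k IH] g h.
  move=> gc hc x; apply: cvgZ (hc x).
  exact: (continuous_comp (gc x) (@coord_continuous _ _ _ 0 j (g x))).
move=> gC hC; have [[dg dgC] [dh dhC]] := (gC, hC).
apply: (@is_diff_class_CS _ _ _
    (fun x v => g x 0 j *: 'd h x v + 'd g x v 0 j *: h x)) => [x|v].
  apply: is_diff_scale (differentiableP (dh x)).
  exact: (is_diff_comp (differentiableP (dg x)) (is_diff_coord _ _ _)).
exact: class_CD (IH _ _ (class_C_leS gC) (dhC v))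
  (IH _ _ (dgC v) (class_C_leS hC)).
Qed.

Lemma class_C_lie (p k : nat) (L : 'rV[R]_m -> 'rV[R]_m)
    (f : 'rV[R]_m -> 'rV[R]_p) :
  class_C k L -> class_C k.+1 f -> class_C k (fun x => 'd f x (L x)).
Proof.
move=> LC [df dfC].
(* [class_C] controls ['d f x v] only for fixed [v], whereas here the direction [L x] moves with
   [x]; expanding it in the standard basis reduces to fixed directions. *)
rewrite (_ : (fun _ => _) =
    fun x => \sum_(i < m) L x 0 i *: 'd f x (delta_mx 0 i)); last first.
  apply/funext => x; rewrite [in LHS](row_sum_delta (L x)) linear_sum.
  by apply: eq_bigr => i _; rewrite linearZ.
by apply: class_C_sum => i; exact: class_C_scale LC (dfC _).
Qed.

End ClassC.

(** * Chain rule along curves *)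

Lemma is_derive_comp_diff (R : realType) (V W : normedModType R)
    (f : V -> W) (g : R -> V) (dg : V) (t : R) :
  is_derive t 1 g dg -> differentiable f (g t) ->
  is_derive t 1 (f \o g) ('d f (g t) dg).
Proof.
move=> gt ft.
have dgt : differentiable g t by apply/derivable1_diffP; exact: ex_derive.
apply: DeriveDef.
  by apply/derivable1_diffP; exact: differentiable_comp.
rewrite deriveE; last exact: differentiable_comp.
by rewrite diff_comp //= -(deriveE _ dgt) (@derive_val _ _ _ _ _ _ _ gt).
Qed.

Lemma is_derive_shift_comp (R : realType) (V : normedModType R) (g : R -> V)
    (dg : V) (a t : R) :
  is_derive (a + t) 1 g dg -> is_derive t 1 (fun s => g (a + s)) dg.
Proof.
move=> ggt.
have dgt : differentiable g (a + t) by apply/derivable1_diffP; exact: ex_derive.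
have da : is_derive t (1 : R) (fun s : R => a + s : R^o) (1 : R^o).
  rewrite (_ : (fun _ => _) = shift a); first exact: is_derive_shift.
  by apply/funext => s; rewrite /= addrC.
have := is_derive_comp_diff da dgt.
by rewrite -(deriveE _ dgt) (@derive_val _ _ _ _ _ _ _ ggt).
Qed.

(** * Taylor expansion at 0 with a bounded remainder *)

Definition taylor_poly (R : realType) (n : nat) (c : nat -> R) : {poly R} :=
  \poly_(k < n) (c k / k`!%:R).

Lemma deriv_taylor_poly (R : realType) (n : nat) (c : nat -> R) :
  (taylor_poly n.+1 c)^`() = taylor_poly n (fun k => c k.+1).
Proof.
apply/polyP => k; rewrite coef_deriv !coef_poly ltnS; case: ifP => _.
  rewrite -(mulr_natr (_ / _)) factS natrM invfM -!mulrA; congr (_ * _).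
  by rewrite mulrCA mulVf ?mulr1 // pnatr_eq0.
by rewrite mul0rn.
Qed.

(** Differentiating function minus polynomial gives the same difference for the shifted family with
    one order less. The mean value theorem thus gains a factor [t] per induction step; the factor
    1/n! is given up, as only the order matters. *)
Lemma taylor_poly_bound (R : realType) (n : nat) (w : nat -> R -> R) (d M : R) :
  (forall k (t : R), (k < n)%N -> 0 <= t < d -> is_derive t 1 (w k) (w k.+1 t)) ->
  (forall t : R, 0 <= t < d -> `|w n t| <= M) ->
  forall t : R, 0 <= t < d ->
    `|w 0 t - (taylor_poly n (w^~ 0)).[t]| <= M * t ^+ n.
Proof.
elim: n w => [|n IH] w wd wM t td.
  by rewrite /taylor_poly poly_def big_ord0 horner0 subr0 mulr1 wM.
have [t0 td'] := andP td.
have M0 : 0 <= M.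
  by apply: le_trans (wM t td); exact: normr_ge0.
pose P := taylor_poly n.+1 (w^~ 0).
have der (s : R) : 0 <= s < d -> is_derive s (1 : R) (fun s => w 0 s - P.[s])
    (w 1 s - (taylor_poly n (fun k => w k.+1 0)).[s]).
  move=> sd; have w0 := wd 0%N s isT sd.
  by rewrite -(deriv_taylor_poly n (w^~ 0)); exact: is_deriveB.
have seg (s : R) : 0 <= s <= t -> 0 <= s < d.
  by move=> /andP[-> /le_lt_trans]; apply.
have [s| |c] := MVT_segment t0 (f := fun s => w 0 s - P.[s])
    (df := fun s => w 1 s - (taylor_poly n (fun k => w k.+1 0)).[s]).
- rewrite in_itv/= => /andP[s0 st]; apply: der; apply: seg.
  by rewrite !ltW.
- apply: derivable_within_continuous => s; rewrite in_itv/= => st.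
  by have [] := der s (seg _ st).
rewrite in_itv/= => /[dup] /andP[c0 ct] /seg cd.
(* The difference vanishes at 0 because the constant coefficient is [w 0 0]. *)
rewrite [P.[0]]horner_coef0 coef_poly/= fact0 divr1 subrr !subr0 => ->.
rewrite normrM (ger0_norm t0) exprSr mulrA ler_wpM2r //.
apply: le_trans (IH (fun k => w k.+1) _ _ c cd) _.
- by move=> k s kn; apply: wd.
- exact: wM.
by rewrite ler_wpM2l // lerXn2r ?nnegrE.
Qed.

(** * Residuals of both stages for one scalar coordinate *)

Section Stages.
Variables (R : realType) (w : nat -> R -> R) (d M : R).
Hypothesis w_derive : forall k (t : R), (k < 5)%N -> 0 <= t < d ->
  is_derive t 1 (w k) (w k.+1 t).
Hypothesis w_bound : forall t : R, 0 <= t < d -> `|w 5 t| <= M.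

Definition taylor_rem (j n : nat) (t : R) : R :=
  w j t - (taylor_poly n (fun k => w (j + k)%N 0)).[t].

Lemma taylor_rem_bound (j n : nat) (t : R) : (j + n)%N = 5%N -> 0 <= t < d ->
  `|taylor_rem j n t| <= M * t ^+ n.
Proof.
move=> jn td; have := @taylor_poly_bound R n (fun k => w (j + k)%N) d M.
rewrite jn /taylor_rem addn0; apply=> // k s kn sd.
by rewrite addnS; apply: w_derive => //; rewrite -jn ltn_add2l.
Qed.

(** The weight [t ^+ j] supplies the powers that a remainder of order [n = 5 - j] lacks. The factor
    [l] places the node: 1/2 for the midpoint, 1 for the endpoint. *)
Lemma scaled_rem_bound (a l t : R) (j n : nat) :
  (j + n)%N = 5%N -> 0 <= t < d -> 0 <= l <= 1 ->
  `|a * t ^+ j * taylor_rem j n (l * t)| <= `|a| * M * t ^+ 5.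
Proof.
move=> jn /andP[t0 td] /andP[l0 l1].
have lt0 : 0 <= l * t by exact: mulr_ge0.
have ltt : l * t <= t by rewrite ler_piMl.
have ltd : 0 <= l * t < d by rewrite lt0 (le_lt_trans ltt td).
have M0 : 0 <= M by apply: le_trans (w_bound ltd); exact: normr_ge0.
rewrite !normrM normrX (ger0_norm t0) -jn exprD -mulrA -[leRHS]mulrA.
rewrite ler_wpM2l // [leRHS]mulrCA ler_wpM2l ?exprn_ge0 //.
apply: le_trans (taylor_rem_bound jn ltd) _.
by rewrite ler_wpM2l // lerXn2r ?nnegrE.
Qed.

Lemma taylor_remE (j n : nat) (t : R) :
  w j t = \sum_(k < n) w (j + k)%N 0 / k`!%:R * t ^+ k + taylor_rem j n t.
Proof.
by rewrite /taylor_rem /taylor_poly horner_poly addrC subrK.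
Qed.

Lemma half_stage_bound (t : R) : 0 <= t < d ->
  `|w 0 (t / 2) - (w 0 0 + t / 4 * (w 1 0 + w 1 (t / 2))
      + t ^+ 2 / 48 * (w 2 0 - w 2 (t / 2)))|
  <= (1 + (4^-1 + 48^-1)) * M * t ^+ 5.
Proof.
move=> td.
have l : 0 <= (2^-1 : R) <= 1 by lra.
rewrite [t / 2]mulrC.
(* The Taylor polynomials cancel exactly, which [field] checks; only weighted remainders survive.
   The factor [1 * t ^+ 0] gives the first one the shape of [scaled_rem_bound]. *)
have -> : w 0 (2^-1 * t) - (w 0 0 + t / 4 * (w 1 0 + w 1 (2^-1 * t))
      + t ^+ 2 / 48 * (w 2 0 - w 2 (2^-1 * t))) =
    1 * t ^+ 0 * taylor_rem 0 5 (2^-1 * t)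
    + (- 4^-1 * t ^+ 1 * taylor_rem 1 4 (2^-1 * t)
       + 48^-1 * t ^+ 2 * taylor_rem 2 3 (2^-1 * t)).
  rewrite (taylor_remE 0 5 (2^-1 * t)) (taylor_remE 1 4 (2^-1 * t)).
  rewrite (taylor_remE 2 3 (2^-1 * t)).
  rewrite !big_ord_recl !big_ord0 /= /bump /= !factS !fact0 !muln1.
  by field.
rewrite !mulrDl; do ![apply: le_trans (ler_normD _ _) (lerD _ _)].
all: apply: le_trans (scaled_rem_bound _ _ td l) _ => //.
all: by rewrite ?normrN ger0_norm.
Qed.

Lemma full_stage_bound (C D t : R) :
  let b := 2 / 3 - 8 * C + 2 * D in
  let g := 1 / 6 + 4 * C - 5 / 2 * D in
  let e := D / 2 - C in
  0 <= t < d ->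
  `|w 0 t - (w 0 0
      + t * ((1 / 6 + 4 * C + D / 2) * w 1 0 + b * w 1 (t / 2) + g * w 1 t)
      + t ^+ 2 * (C * w 2 0 + D * w 2 (t / 2) + e * w 2 t))|
  <= (1 + (`|b| + (`|g| + (`|D| + `|e|)))) * M * t ^+ 5.
Proof.
move=> b g e td.
have l : 0 <= (2^-1 : R) <= 1 by lra.
have l1 : 0 <= (1 : R) <= 1 by lra.
rewrite [t / 2]mulrC.
(* The cancellation is an identity in [C] and [D]. Values at 0 carry no remainder, so the weights of
   [w 1 0] and [w 2 0] leave no term here. *)
have -> : w 0 t - (w 0 0
      + t * ((1 / 6 + 4 * C + D / 2) * w 1 0 + b * w 1 (2^-1 * t) + g * w 1 t)
      + t ^+ 2 * (C * w 2 0 + D * w 2 (2^-1 * t) + e * w 2 t)) =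
    1 * t ^+ 0 * taylor_rem 0 5 (1 * t)
    + (- b * t ^+ 1 * taylor_rem 1 4 (2^-1 * t)
    + (- g * t ^+ 1 * taylor_rem 1 4 (1 * t)
    + (- D * t ^+ 2 * taylor_rem 2 3 (2^-1 * t)
    + - e * t ^+ 2 * taylor_rem 2 3 (1 * t)))).
  rewrite !mul1r (taylor_remE 0 5 t) (taylor_remE 1 4 (2^-1 * t)).
  rewrite (taylor_remE 2 3 (2^-1 * t)) (taylor_remE 1 4 t) (taylor_remE 2 3 t).
  rewrite !big_ord_recl !big_ord0 /= /bump /= !factS !fact0 !muln1 /b /g /e.
  by field.
rewrite !mulrDl; do ![apply: le_trans (ler_normD _ _) (lerD _ _)].
all: apply: le_trans (scaled_rem_bound _ _ td _) _ => //.
all: by rewrite ?normrN ?normr1.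
Qed.

End Stages.

(** * Time derivatives of a solution as iterated Lie derivatives *)

Section Trajectory.
Variables (R : realType) (m : nat) (L : 'rV[R]_m -> 'rV[R]_m).

(** The iterated Lie derivative along [L], started at [L] and not at the identity; the (k+1)-st time
    derivative of a solution is therefore [lie_iter k] on it. *)
Definition lie_iter (k : nat) : 'rV[R]_m -> 'rV[R]_m :=
  iter k (fun f x => 'd f x (L x)) L.

Lemma calGE (x : 'rV[R]_m) : calG L x = lie_iter 1 x.
Proof. by rewrite /calG /jacobian mul_rV_lin1. Qed.

(** Each Lie derivative costs one order of smoothness. *)
Lemma class_C_lie_iter (j k : nat) :
  class_C (j + k) L -> class_C k (lie_iter j).
Proof.
elim: j k => [|j IH] k LC //.
apply: class_C_lie; first by apply: class_C_le LC; exact: leq_addl.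
by apply: IH; rewrite addnS.
Qed.

Definition traj_derivative (u : R -> 'rV[R]_m) (k : nat) : R -> 'rV[R]_m :=
  if k is k'.+1 then lie_iter k' \o u else u.

Lemma is_derive_traj (n : nat) (u : R -> 'rV[R]_m) (I : set R) :
  class_C n L -> solves_on L u I ->
  forall k t, (k <= n)%N -> I t ->
    is_derive t 1 (traj_derivative u k) (traj_derivative u k.+1 t).
Proof.
move=> LC uI [|k] t kn It; first exact: uI.
have [df _] : class_C 1 (lie_iter k).
  by apply: class_C_lie_iter; apply: class_C_le LC; rewrite addn1.
exact: (is_derive_comp_diff (uI t It) (df (u t))).
Qed.

(** For [L] of class C^n, the derivative of order n+1 is [lie_iter n] composed with [u]. The former
    is of class C^0, so the composite is continuous at [a], hence bounded nearby. *)
Lemma traj_derivative_bounded (n : nat) (u : R -> 'rV[R]_m) (I : set R) (a : R) :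
  class_C n L -> open I -> solves_on L u I -> I a ->
  exists d M : R, [/\ 0 < d, 0 <= M,
    forall t, 0 <= t < d -> I (a + t) &
    forall t, 0 <= t < d -> `|traj_derivative u n.+1 (a + t)| <= M].
Proof.
move=> LC Iopen uI Ia.
have uc : {for a, continuous u}.
  apply/differentiable_continuous/derivable1_diffP.
  exact: (@ex_derive _ _ _ _ _ _ _ (uI a Ia)).
have vc : {for a, continuous (traj_derivative u n.+1)}.
  apply: continuous_comp uc _; apply: class_C_continuous (0%N) _ _ _.
  by apply: class_C_lie_iter; rewrite addn0.
have [M M0 bM] := pinfty_ex_gt0 (cvg_bounded _ _ vc).
have : \forall t \near a, I t /\ `|traj_derivative u n.+1 t| <= M.
  by near=> t; split; near: t => //; exact: open_nbhs_nbhs.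
move=> /nbhs_ballP[d d0 dP]; exists d, M.
have near_a t : 0 <= t < d -> ball a d (a + t).
  move=> /andP[t0 td].
  by rewrite -ball_normE /= opprD addNKr normrN ger0_norm.
by split=> // [|t /near_a/dP[]|t /near_a/dP[]]//; exact: ltW.
Unshelve. all: by end_near. Qed.

End Trajectory.

(** * From coordinatewise bounds to the vector estimates *)

Lemma eqaddO_pow_coord (R : realType) (m n : nat) (f g : R -> 'rV[R]_m)
    (d K : R) :
  0 < d -> 0 <= K ->
  (forall t i, 0 <= t < d -> `|f t 0 i - g t 0 i| <= K * t ^+ n) ->
  f = g +O_ (0^'+) (fun t : R => t ^+ n).
Proof.
(* The witness must be positive, while [K] may be 0. *)
move=> d0 K0 fg; apply/eqaddOP/bigO_exP; exists (K + 1).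
  by rewrite ltr_wpDl.
near=> t.
have t0 : 0 < t by [].
have td : t < d by near: t; exact: nbhs_right_lt.
have tn0 : 0 <= t ^+ n by rewrite exprn_ge0 // ltW.
rewrite (ger0_norm tn0); apply: (@le_trans _ _ (K * t ^+ n)); last first.
  by rewrite ler_wpM2r // lerDl.
(* The norm is the maximum of the coordinates, started at 0; the bound must also dominate that
   starting value. *)
rewrite [leLHS]/Num.Def.normr/= mx_normrE.
apply: bigmax_le => [|[i j] _ /=]; first exact: mulr_ge0.
by rewrite (ord1 i) !mxE; apply: fg; rewrite (ltW t0) td.
Unshelve. all: by end_near. Qed.

Theorem mainTheorem1 (R : realType) (m : nat) (L : 'rV[R]_m -> 'rV[R]_m)
    (L_C4 : class_C 4 L)
    (I : set R) (I_open : open I) (I_itv : is_interval I)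
    (u : R -> 'rV[R]_m) (u_sol : solves_on L u I)
    (tn : R) (I_tn : I tn)
    (C D : R) :
  let G := calG L in
  let u0 := u tn in
  let uh := fun dt : R => u (tn + dt / 2) in
  let u1 := fun dt : R => u (tn + dt) in
  (uh =
     (fun dt : R => u0
        + (dt / 4) *: (L u0 + L (uh dt))
        + (dt ^+ 2 / 48) *: (G u0 - G (uh dt)))
     +O_ (0^'+) (fun dt : R => dt ^+ 5))
  /\
  (u1 =
     (fun dt : R => u0
        + dt *: ((1 / 6 + 4 * C + D / 2) *: L u0
                 + (2 / 3 - 8 * C + 2 * D) *: L (uh dt)
                 + (1 / 6 + 4 * C - 5 / 2 * D) *: L (u1 dt))
        + dt ^+ 2 *: (C *: G u0 + D *: G (uh dt) + (D / 2 - C) *: G (u1 dt)))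
     +O_ (0^'+) (fun dt : R => dt ^+ 5)).
Proof.
move=> G u0 uh u1.
have [d [M [d0 M0 Id bM]]] := traj_derivative_bounded L_C4 I_open u_sol I_tn.
(* The k-th derivative of coordinate [i], with time shifted so that [tn] becomes 0. *)
pose w (i : 'I_m) (k : nat) (t : R) := traj_derivative L u k (tn + t) 0 i.
have w_derive i k (t : R) : (k < 5)%N -> 0 <= t < d ->
    is_derive t 1 (w i k) (w i k.+1 t).
  move=> k5 td; have := is_derive_traj L_C4 u_sol k5 (Id t td).
  move=> /is_derive_shift_comp /is_derive_comp_diff.
  move=> /(_ _ _ (differentiable_coord _ 0 i)).
  by rewrite (@diff_val _ _ _ _ _ _ _ (is_diff_coord _ 0 i)).
have w_bound i (t : R) : 0 <= t < d -> `|w i 5 t| <= M.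
  move=> /bM; apply: le_trans.
  rewrite [leRHS]/Num.Def.normr/= mx_normrE.
  exact: (le_bigmax _ (fun ij => `|_ ij.1 ij.2|) (0, i)).
have w00 i : w i 0 0 = u tn 0 i by rewrite /w addr0.
have w10 i : w i 1 0 = L (u tn) 0 i by rewrite /w addr0.
have w20 i : w i 2 0 = G (u tn) 0 i by rewrite /w addr0 /G calGE.
have w0 i t : w i 0 t = u (tn + t) 0 i by [].
have w1 i t : w i 1 t = L (u (tn + t)) 0 i by [].
have w2 i t : w i 2 t = G (u (tn + t)) 0 i by rewrite /G calGE.
(* From here on, [w] and [G] are known only through the coordinate identities and bounds above. *)
clearbody w G; rewrite {}/u1 {}/uh {}/u0; split.
- apply: (eqaddO_pow_coord d0 (K := (1 + (4^-1 + 48^-1)) * M)).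
    by rewrite mulr_ge0.
  move=> t i /(half_stage_bound (w_derive i) (w_bound i)).
  by rewrite w00 w10 w20 w0 w1 w2 /= !mxE.
pose K := (1 + (`|2 / 3 - 8 * C + 2 * D| + (`|1 / 6 + 4 * C - 5 / 2 * D|
  + (`|D| + `|D / 2 - C|)))) * M.
apply: (eqaddO_pow_coord d0 (K := K)).
  by rewrite mulr_ge0 // !addr_ge0.
move=> t i /(full_stage_bound (w_derive i) (w_bound i) C D).
by rewrite w00 w10 w20 w0 !w1 !w2 /= !mxE.
Qed.
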